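(* Let $X$ be a good random variable with rate function $\Lambda_*$. Let $K_{n,n}=([n],[n],[n]\times[n])$ be the complete bipartite graph, and assign to each edge $e\in[n]\times[n]$ a weight $X_e$, where the $X_e$ are independent copies of $X$. Let $\mathscr{C}_n$ be the set of perfect matchings of $K_{n,n}$ and \[ W_n=\max\Big\{\sum_{e\in E(M)}X_e:\ M\in\mathscr{C}_n\Big\}. \] Then $W_n=(1+o(1))\,n\,\Lambda_*^{-1}(\log n)$ with high probability, i.e. there is a deterministic sequence $\varepsilon_n\to 0$ such that \[ \mathbb{P}\Big((1-\varepsilon_n)\,n\,\Lambda_*^{-1}(\log n)\le W_n\le (1+\varepsilon_n)\,n\,\Lambda_*^{-1}(\log n)\Big)\to 1 \quad (n\to\infty). \]
   Context: For a random variable $X$, $\Lambda(t)=\log\mathbb{E}e^{tX}\in(-\infty,+\infty]$ is its log-moment generating function and $\Lambda_*(t)=\sup_{s\in\mathbb{R}}\{st-\Lambda(s)\}$ its Legendre transform (rate function). $X$ has regular upper tails if $\mathbb{P}(X>t)=\exp(-(1+o(1))\Lambda_*(t))$ as $t\to+\infty$, i.e. $-\log\mathbb{P}(X>t)/\Lambda_*(t)\to1$ (this is vacuous if $X$ is bounded above, as then $\mathbb{P}(X>t)=0$ and $\Lambda_*(t)=+\infty$ for $t$ beyond the essential supremum). $X$ is called good if it is symmetric ($-X$ has the same distribution as $X$), $\Lambda(t)<\infty$ for all $|t|<\delta$ for some $\delta>0$, and $X$ has regular upper tails. For $t\ge0$, $\Lambda_*^{-1}(t)=\inf\{s:\Lambda_*(s)\ge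 t\}$ denotes the generalised inverse of $\Lambda_*$.
   Formalization: The infimum defining the generalised inverse of the rate function is taken over s ≥ 0; since X is symmetric the rate function is even, and the infimum over all real s would be minus infinity. *)

(* Defs.v *)
From HB Require Import structures.
From mathcomp Require Import all_boot all_order all_algebra.
From mathcomp Require Import all_classical all_reals all_analysis.
From mathcomp Require Import measurable_realfun.

Set Implicit Arguments.
Unset Strict Implicit.
Unset Printing Implicit Defensive.

Import Order.TTheory GRing.Theory Num.Theory.
Import numFieldNormedType.Exports.

Local Open Scope classical_set_scope.
Local Open Scope ring_scope.
Local Open Scope ereal_scope.

Section rate_function.
Context d (T : measurableType d) (R : realType) (P : probability T R).
Variable X : {RV P >-> R}.

Definition log_mgf (t : R) : \bar R := lne ('M_P X t).

Definition rate (t : R) : \bar R :=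
  ereal_sup [set (s * t)%:E - log_mgf s | s in [set: R]].

(* The infimum runs over s >= 0: for symmetric X the function [rate] is even,
   so over the whole line it would be -oo for every t that [rate] reaches. *)
Definition rate_inv (t : R) : \bar R :=
  ereal_inf [set s%:E | s in [set s : R | (0 <= s)%R /\ t%:E <= rate s]].

(* Where [rate t] is +oo, the equation reads P(X > t) = expeR -oo = 0. *)
Definition regular_upper_tails : Prop :=
  exists2 h : R -> R, h t @[t --> +oo%R] --> (0 : R)%R &
    \forall t \near +oo%R,
      P [set w | (t < X w)%R] = expeR (- ((1 + h t)%:E * rate t)).

End rate_function.

(* Laws are compared on measurable sets only, as the values of a measure
   elsewhere carry no meaning. *)
Definition same_law d1 d2 (T1 : measurableType d1) (T2 : measurableType d2)
    (R : realType) (P1 : probability T1 R) (P2 : probability T2 R)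
    (X1 : {RV P1 >-> R}) (X2 : {RV P2 >-> R}) : Prop :=
  forall A : set R, measurable A ->
    distribution P1 X1 A = distribution P2 X2 A.

Definition symmetric_RV d (T : measurableType d) (R : realType)
    (P : probability T R) (X : {RV P >-> R}) : Prop :=
  same_law (P1 := P) (P2 := P) (- X)%R X.

Definition good_RV d (T : measurableType d) (R : realType)
    (P : probability T R) (X : {RV P >-> R}) : Prop :=
  [/\ symmetric_RV X,
      exists2 delta : R, (0 < delta)%R &
        forall t : R, (`|t| < delta)%R -> log_mgf X t < +oo &
      regular_upper_tails X].

Definition independent_RVs d (T : measurableType d) (R : realType)
    (P : probability T R) (I : finType) (X : I -> {RV P >-> R}) : Prop :=
  forall (J : {set I}) (A : I -> set R),
    (forall i, i \in J -> measurable (A i)) ->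
    P (\bigcap_(i in [set` J]) (X i @^-1` A i)) =
      \prod_(i in J) P (X i @^-1` A i).

(* A bipartite graph with vertex classes U and V is given by its edge set
   E : {set U * V}. *)
Definition perfect_matching (U V : finType) (E M : {set U * V}) : bool :=
  [&& M \subset E,
      [forall u : U, #|[set e in M | e.1 == u]| == 1%N] &
      [forall v : V, #|[set e in M | e.2 == v]| == 1%N]].

Definition complete_bipartite (n : nat) : {set 'I_n * 'I_n} := [set: 'I_n * 'I_n].

(* The maximum is taken in \bar R so that -oo can serve as the neutral element;
   it is finite because the complete bipartite graph has a perfect matching. *)
Definition max_matching_weight (R : realType) (n : nat)
    (x : 'I_n * 'I_n -> R) : \bar R :=
  \big[maxe/-oo]_(M : {set 'I_n * 'I_n}
                 | perfect_matching (complete_bipartite n) M)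
     (\sum_(e in M) x e)%:E.

(* Main.v *)
(* Write L for [rate_inv X (ln n)]. Upper bound: by Chernoff a fixed perfect
   matching has weight larger than n L with probability at most n^-n, and there
   are n! perfect matchings, so W_n <= n L up to probability n!/n^n <= 1/n.

   Lower bound: keep the edges of weight at least (1 - e) L. The rate function
   is convex and vanishes at 0, so [rate X ((1 - a)^2 L) <= (1 - a) ln n], and
   the regular tails turn this into P(X >= (1 - e) L) >= n^(c - 1) for some
   c > 0. (If L stays bounded as n grows, this probability is even bounded away
   from 0.) By Hall's theorem, if the kept edges contain no perfect matching,
   some A x B with |A| + |B| = n + 1 contains no kept edge, and a union bound
   over A and B shows that this has probability at most 1/n. The fixed e is
   finally replaced by a sequence tending to 0 by a diagonal argument. *)
Require Import Defs.
From HB Require Import structures.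
From mathcomp Require Import all_boot all_order all_algebra all_fingroup.
From mathcomp Require Import all_classical all_reals all_analysis.
From mathcomp Require Import measurable_realfun ring lra zify.
Import Order.TTheory GRing.Theory Num.Theory.
Import numFieldNormedType.Exports.

Set Implicit Arguments.
Unset Strict Implicit.
Unset Printing Implicit Defensive.

(** * Perfect matchings of bipartite graphs *)

(** Rado's deletion argument, by induction on the total size of the sets [N u]. If all are
    singletons, Hall's condition forces distinct choices. Otherwise some [N u] has two elements, and
    submodularity shows that one of them can be deleted. *)
Lemma hall (U V : finType) (N : U -> {set V}) :
  (forall S : {set U}, #|S| <= #|\bigcup_(u in S) N u|) ->
  exists2 f : U -> V, injective f & forall u, f u \in N u.
Proof.
have [m] := ubnP (\sum_u #|N u|); elim: m N => // m IH N; rewrite ltnS => Nm hallN.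
have [/existsP[u Nu]|/existsPn N1] := boolP [exists u, 1 < #|N u|]; last first.
  have /fin_all_exists[f Nf] u : exists x, N u = [set x].
    apply/cards1P; rewrite eqn_leq leqNgt N1 /=.
    by have := hallN [set u]; rewrite big_set1 cards1.
  exists f => [u v fuv|u]; last by rewrite Nf set11.
  apply/eqP; apply: contraT => uv; have := hallN [set u; v].
  by rewrite big_setU1 ?inE// big_set1 !Nf fuv /= finset.setUid cards1 cards2 uv.
pose N' x v := if v == u then N u :\ x else N v.
have N'sub x v : N' x v \subset N v.
  by rewrite /N'; case: eqP => [->|_//]; exact: subsetDl.
(* If deleting [x] from [N u] breaks Hall's condition, the violating set
   contains [u]. *)
have violation x : x \in N u ->
    (exists2 f : U -> V, injective f & forall v, f v \in N v) \/
    exists2 A : {set U}, u \notin A &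
      #|\bigcup_(v in A) N v :|: (N u :\ x)| <= #|A|.
  move=> xNu.
  have [/forallP hN'|/forallPn[S]] :=
      boolP [forall S : {set U}, #|S| <= #|\bigcup_(v in S) N' x v|].
    left; have [|f finj fN] := IH (N' x) _ hN'.
      apply: leq_trans Nm; rewrite (bigD1 u)//= [ltnRHS](bigD1 u)//= -addSn.
      apply: leq_add; last by apply: leq_sum => v _; exact/subset_leq_card.
      by rewrite /N' eqxx [ltnRHS](cardsD1 x) xNu.
    by exists f => // v; exact: (fintype.subsetP (N'sub x v)).
  rewrite -ltnNge => hS; right; exists (S :\ u); first by rewrite !inE eqxx.
  have eqN' (A : {set U}) : u \notin A ->
      \bigcup_(v in A) N' x v = \bigcup_(v in A) N v.
    move=> uA; apply: eq_bigr => v vA; rewrite /N' ifF//.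
    by apply: contraNF uA => /eqP <-.
  have uS : u \in S.
    apply: contraLR hS => uS; rewrite eqN'// -leqNgt; exact: hallN.
  rewrite finset.setUC -(eqN' (S :\ u)) ?inE ?eqxx//.
  move: hS; rewrite (big_setD1 u uS)/= [ltnRHS](cardsD1 u) uS.
  by rewrite {1}/N' eqxx ltnS.
have [x [y [xN yN xy]]] : exists x, exists y, [/\ x \in N u, y \in N u & x != y].
  by have /card_gt1P[x [y [? ? ?]]] := Nu; exists x, y.
have [//|[A uA hA]] := violation x xN.
have [//|[B uB hB]] := violation y yN.
exfalso; move: hA hB.
set P := _ :|: _ => hA; set Q := _ :|: _ => hB.
(* As [x != y], the union of [P] and [Q] recovers all of [N u], hence contains every neighbour of
   [u |: (A :|: B)]. *)
have hPQ : #|A :|: B|.+1 <= #|P :|: Q|.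
  have -> : #|A :|: B|.+1 = #|u |: (A :|: B)| by rewrite cardsU1 inE negb_or uA uB.
  apply: leq_trans (hallN _) _; apply/subset_leq_card/finset.bigcupsP => v.
  rewrite !inE => /orP[/eqP->|/orP[vA|vB]]; apply/fintype.subsetP => z zN; rewrite !inE.
  - case: (eqVneq z x) => [->|]; last by rewrite zN orbT.
    by rewrite xy xN !orbT.
  - by rewrite (fintype.subsetP (finset.bigcup_sup v vA)).
  - by rewrite (fintype.subsetP (finset.bigcup_sup v vB)) ?orbT.
have hPIQ : #|A :&: B| <= #|P :&: Q|.
  apply: leq_trans (hallN _) _; apply/subset_leq_card/finset.bigcupsP => v.
  rewrite inE => /andP[vA vB]; apply/fintype.subsetP => z zN; rewrite !inE.
  rewrite (fintype.subsetP (finset.bigcup_sup v vA))//.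
  by rewrite (fintype.subsetP (finset.bigcup_sup v vB)).
have := leq_add hPQ hPIQ; rewrite addSn !cardsUI ltnNge => /negP; apply.
exact: leq_add.
Qed.

Definition graph_set (n : nat) (f : 'I_n -> 'I_n) : {set 'I_n * 'I_n} :=
  [set (u, f u) | u : 'I_n].

Lemma in_graph_set n (f : 'I_n -> 'I_n) (e : 'I_n * 'I_n) :
  (e \in graph_set f) = (e.2 == f e.1).
Proof.
by apply/imsetP/eqP => [[u _ ->]//|]; case: e => u v /= ->; exists u.
Qed.

Lemma card_graph_set n (f : 'I_n -> 'I_n) : #|graph_set f| = n.
Proof. by rewrite card_imset ?card_ord// => u v []. Qed.

Lemma perfect_graph_set n (f : 'I_n -> 'I_n) (E : {set 'I_n * 'I_n}) :
  injective f -> (forall u, (u, f u) \in E) -> perfect_matching E (graph_set f).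
Proof.
move=> finj fE; have [g fK gK] := injF_bij finj; apply/and3P; split.
- by apply/fintype.subsetP => e /imsetP[u _ ->].
- apply/forallP => u; apply/cards1P; exists (u, f u); apply/setP => -[a b].
  rewrite !inE in_graph_set /= xpair_eqE andbC.
  by case: eqP => // ->.
- apply/forallP => v; apply/cards1P; exists (g v, v); apply/setP => -[a b].
  rewrite !inE in_graph_set /= xpair_eqE andbC.
  by case: eqP => [->|]; rewrite ?andbF ?andbT//= eq_sym (can2_eq fK gK).
Qed.

(** The row condition makes [M] the graph of a function, and the column condition makes that
    function injective. *)
Lemma perfect_matching_perm n (E M : {set 'I_n * 'I_n}) :
  perfect_matching E M -> exists s : 'S_n, M = graph_set s.
Proof.
move=> /and3P[_ /forallP rowM /forallP colM].
have /fin_all_exists[f fM] u : exists v, [set e in M | e.1 == u] = [set (u, v)].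
  have /cards1P[[a v] Mu] := rowM u; exists v.
  have : (a, v) \in [set e in M | e.1 == u] by rewrite Mu set11.
  by rewrite inE /= Mu => /andP[_ /eqP <-].
have inM u v : ((u, v) \in M) = (v == f u).
  have := congr1 (fun S : {set _} => (u, v) \in S) (fM u).
  by rewrite /= !inE/= eqxx andbT xpair_eqE eqxx.
have finj : injective f.
  move=> u v fuv; have /cards1P[e Me] := colM (f u).
  have : (u, f u) \in [set e in M | e.2 == f u] by rewrite inE inM /= !eqxx.
  have : (v, f u) \in [set e in M | e.2 == f u] by rewrite inE inM /= fuv !eqxx.
  by rewrite Me !inE => /eqP <- /eqP [].
exists (perm finj); apply/setP => -[u v].
by rewrite in_graph_set inM /= permE.
Qed.

Lemma card_perfect_matching n (E M : {set 'I_n * 'I_n}) :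
  perfect_matching E M -> #|M| = n.
Proof. by move=> /perfect_matching_perm[s ->]; exact: card_graph_set. Qed.

Lemma card_perfect_matchings n (E : {set 'I_n * 'I_n}) :
  #|[set M | perfect_matching E M]| <= n`!.
Proof.
rewrite -card_Sn; pose S := [set graph_set s | s : 'S_n].
apply: (@leq_trans #|S|); last first.
  exact: leq_imset_card.
apply/subset_leq_card/fintype.subsetP => M; rewrite inE => /perfect_matching_perm[s ->].
by apply/imsetP; exists s.
Qed.

(** If Hall's condition fails at [A], at least [n.+1 - #|A|] vertices have no neighbour in [A], and
    [B] is taken among them. *)
Lemma perfect_matching_or_hole n (E : {set 'I_n * 'I_n}) :
  (exists M, perfect_matching E M) \/
  exists A B : {set 'I_n}, #|A| + #|B| = n.+1 /\
    forall e, e \in finset.setX A B -> e \notin E.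
Proof.
pose N u := [set v | (u, v) \in E].
have [/forallP hN|/forallPn[A]] :=
    boolP [forall S : {set 'I_n}, #|S| <= #|\bigcup_(u in S) N u|].
  have [f finj fN] := hall hN; left; exists (graph_set f).
  by apply: perfect_graph_set => // u; have := fN u; rewrite inE.
rewrite -ltnNge => hA; right; set NA := \bigcup_(u in A) N u in hA.
have : n.+1 - #|A| <= #|~: NA|.
  by have := cardsC NA; rewrite card_ord; lia.
(* Exactly [n.+1 - #|A|] of these vertices are kept, so that [#|A|] determines [#|B|] in the later
   union bound. *)
move=> /card_geqP[s [us sz sN]]; exists A, [set x in s]; split.
  rewrite cardsE (card_uniqP us) sz subnKC//.
  by have := max_card A; rewrite card_ord; lia.
move=> [u v] /setXP[uA]; rewrite !inE => /sN; rewrite inE; apply: contra => uv.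
by apply/finset.bigcupP; exists u => //; rewrite inE.
Qed.

Local Open Scope classical_set_scope.
Local Open Scope ring_scope.
Local Open Scope ereal_scope.

(** * Expectations of products of independent variables *)

Section independence.
Import HBNNSimple.
Context d (T : measurableType d) (R : realType) (P : probability T R).

Lemma measurable_preimage_RV (X : {RV P >-> R}) (A : set R) :
  measurable A -> measurable (X @^-1` A).
Proof. by move=> mA; rewrite -[X in measurable X]setTI; exact: measurable_funPT. Qed.

Lemma measurable_indic_RV (X : {RV P >-> R}) (A : set R) :
  measurable A -> measurable_fun setT (fun w => \1_A (X w) : R).
Proof.
move=> mA; have -> : (fun w => \1_A (X w)) = \1_(X @^-1` A) :> (T -> R).
  by apply/funext => w; rewrite !indicE.
by apply: measurable_indic; exact: measurable_preimage_RV.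
Qed.

Lemma integral_indic_RV (X : {RV P >-> R}) (A : set R) :
  measurable A -> \int[P]_w (\1_A (X w))%:E = P (X @^-1` A).
Proof.
move=> mA; rewrite -[Y in _ = P Y]setIT -(integral_indic P measurableT)//.
exact: measurable_preimage_RV.
Qed.

(** The last hypothesis is the factorisation for indicators. Linearity extends it to the simple
    functions [g n] approximating [f], and monotone convergence to [f]. *)
Lemma integral_mul_comp_indep (Z : T -> R) (X : {RV P >-> R}) (f : R -> R) :
  measurable_fun setT Z -> (forall w, (0 <= Z w)%R) ->
  measurable_fun setT f -> (forall x, (0 <= f x)%R) ->
  \int[P]_w (Z w)%:E < +oo ->
  (forall A, measurable A ->
    \int[P]_w (Z w * \1_A (X w))%:E = \int[P]_w (Z w)%:E * P (X @^-1` A)) ->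
  \int[P]_w (Z w * f (X w))%:E = \int[P]_w (Z w)%:E * \int[P]_w (f (X w))%:E.
Proof.
move=> mZ Z0 mf f0 Zoo indep.
have IZ0 : 0 <= \int[P]_w (Z w)%:E by apply: integral_ge0 => w _; rewrite lee_fin.
have Zfin : \int[P]_w (Z w)%:E \is a fin_num by rewrite ge0_fin_numE.
have mEf : measurable_fun setT (EFin \o f) by exact/measurable_EFinP.
pose g := nnsfun_approx measurableT mEf.
have g0 n x : (0 <= g n x)%R by exact: fun_ge0.
have mgX n : measurable_fun setT (fun w => g n (X w)).
  by apply: (measurableT_comp (f := g n)) => //; exact: measurable_funPT.
have simple n : \int[P]_w (Z w * g n (X w))%:E =
    \int[P]_w (Z w)%:E * \int[P]_w (g n (X w))%:E.
  have fing : finite_set (range (g n)) by exact: fimfunP.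
  have mg r : measurable (g n @^-1` [set r]) by exact: measurable_funPTI.
  have mX r : measurable_fun setT (fun w => \1_(g n @^-1` [set r]) (X w) : R).
    exact: measurable_indic_RV.
  (* The real [r] may be negative here, but on its fibre it equals [g n x], so the product is
     nonnegative for every [r]. *)
  have g1 (r x : R) :
      (r * \1_(g n @^-1` [set r]) x = g n x * \1_(g n @^-1` [set r]) x)%R.
    rewrite indicE; case: (boolP (x \in _)); last by rewrite !mulr0.
    by rewrite inE => /= ->.
  have g1X (r x : R) : (0 <= r * \1_(g n @^-1` [set r]) x)%R.
    by rewrite g1 mulr_ge0// indicE.
  transitivity (\int[P]_w \sum_(r \in range (g n))
      (r * (Z w * \1_(g n @^-1` [set r]) (X w)))%:E).
    apply: eq_integral => w _; rewrite fsumEFin//; congr _%:E.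
    rewrite [in LHS](fimfunE (g n)) mulr_fsumr//.
    by apply: eq_fsbigr => r _; rewrite mulrCA.
  rewrite ge0_integral_fsum//; last first.
  - by move=> r w _; rewrite lee_fin mulrCA mulr_ge0.
  - move=> r; apply/measurable_EFinP.
    by do 2 apply: measurable_funM => //.
  transitivity (\int[P]_w (Z w)%:E * \int[P]_w \sum_(r \in range (g n))
      (r * \1_(g n @^-1` [set r]) (X w))%:E); last first.
    congr *%E; apply: eq_integral => w _.
    by rewrite fsumEFin// -(fimfunE (g n)).
  rewrite ge0_integral_fsum//; last first.
  - by move=> r w _; rewrite lee_fin.
  - by move=> r; apply/measurable_EFinP; apply: measurable_funM.
  rewrite ge0_mule_fsumr; last first.
    by move=> r; apply: integral_ge0 => w _; rewrite lee_fin.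
  apply: eq_fsbigr => r; rewrite inE => -[x _ xr].
  have r0 : (0 <= r)%R by rewrite -xr.
  under eq_integral do rewrite EFinM.
  rewrite ge0_integralZl_EFin//; first last.
  - by apply/measurable_EFinP; apply: measurable_funM.
  - by move=> w _; rewrite lee_fin mulr_ge0// indicE.
  under [in RHS]eq_integral do rewrite EFinM.
  rewrite ge0_integralZl_EFin//; last exact/measurable_EFinP.
  by rewrite indep// muleCA integral_indic_RV.
have gE x : (fun n => (g n x)%:E) @ \oo --> (f x)%:E.
  by apply: (cvg_nnsfun_approx measurableT mEf) => // y _; rewrite lee_fin.
have gnd x : {homo (fun n => g n x) : n m / (n <= m)%N >-> (n <= m)%R}.
  by move=> n m nm; have /lefP := nd_nnsfun_approx measurableT mEf nm; exact.
have cvgR : (fun n => \int[P]_w (g n (X w))%:E) @ \oo -->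
    \int[P]_w (f (X w))%:E.
  have := @cvg_monotone_convergence _ _ _ P setT measurableT
    (fun n w => (g n (X w))%:E).
  under [X in _ --> X]eq_integral do rewrite (cvg_lim _ (gE _))//.
  apply => [n|n w _|w _ n m nm].
  - exact/measurable_EFinP.
  - by rewrite lee_fin.
  - by rewrite lee_fin gnd.
have cvgL : (fun n => \int[P]_w (Z w * g n (X w))%:E) @ \oo -->
    \int[P]_w (Z w * f (X w))%:E.
  have ZgE w : (fun n => (Z w * g n (X w))%:E) @ \oo --> (Z w * f (X w))%:E.
    rewrite EFinM; under eq_fun do rewrite EFinM.
    exact: cvgeZl.
  have := @cvg_monotone_convergence _ _ _ P setT measurableT
    (fun n w => (Z w * g n (X w))%:E).
  under [X in _ --> X]eq_integral do rewrite (cvg_lim _ (ZgE _))//.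
  apply => [n|n w _|w _ n m nm].
  - by apply/measurable_EFinP; apply: measurable_funM.
  - by rewrite lee_fin mulr_ge0.
  - by rewrite lee_fin ler_wpM2l// gnd.
apply: (cvg_unique _ cvgL) => //.
rewrite (_ : (fun n => _) = fun n =>
    \int[P]_w (Z w)%:E * \int[P]_w (g n (X w))%:E); last exact/funext.
exact: cvgeZl.
Qed.

(** Turns independence of events into the product rule for expectations, which Chernoff's inequality
    applies to exponentials. *)
Lemma integral_prod_indep (I : finType) (X : I -> {RV P >-> R})
    (f : I -> R -> R) (J : {set I}) :
  independent_RVs X ->
  (forall i, measurable_fun setT (f i)) -> (forall i x, (0 <= f i x)%R) ->
  (forall i, \int[P]_w (f i (X i w))%:E < +oo) ->
  \int[P]_w (\prod_(i in J) f i (X i w))%:E =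
    \prod_(i in J) \int[P]_w (f i (X i w))%:E.
Proof.
move=> indep.
have mfX (g : R -> R) i : measurable_fun setT g ->
    measurable_fun setT (fun w => g (X i w)).
  by move=> mg; apply: (measurableT_comp mg); exact: measurable_funPT.
have mprod (g : I -> R -> R) (Q : pred I) : (forall i, measurable_fun setT (g i)) ->
    measurable_fun setT (fun w => \prod_(i | Q i) g i (X i w) : R)%R.
  move=> mg; rewrite (_ : (fun w => _) = fun w =>
      \prod_i (if Q i then g i (X i w) else 1))%R; last first.
    by apply/funext => w; exact: big_mkcond.
  by apply: measurable_prod => i _; case: (Q i) => //; exact: mfX.
(* Indicators are replaced by general functions one index at a time: [s]
   lists the indices where the function is already general. *)
suff claim (s : seq I) : forall f : I -> R -> R,
    (forall i, measurable_fun setT (f i)) -> (forall i x, (0 <= f i x)%R) ->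
    (forall i, \int[P]_w (f i (X i w))%:E < +oo) ->
    (forall i, i \notin s -> exists2 A, measurable A & f i = \1_A) ->
    \int[P]_w (\prod_(i in J) f i (X i w))%:E =
      \prod_(i in J) \int[P]_w (f i (X i w))%:E.
  move=> mf f0 foo; apply: (claim (enum I)) => // i.
  by rewrite mem_enum.
elim: s => [|k s IH] {}f mf f0 foo fA.
  have /choice[A fAE] i : exists A, measurable A /\ f i = \1_A.
    by have [//|A mA ->] := fA i; exists A.
  have mA i : measurable (A i) by have [] := fAE i.
  have {}fAE i : f i = \1_(A i) by have [] := fAE i.
  transitivity (P (\bigcap_(i in [set` J]) (X i @^-1` A i))); last first.
    by rewrite indep//; apply: eq_bigr => i _; rewrite -integral_indic_RV// fAE.
  have mXA : measurable (\bigcap_(i in [set` J]) (X i @^-1` A i)).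
    apply: fin_bigcap_measurable => // i _.
    exact: measurable_preimage_RV.
  rewrite -[Y in _ = P Y]setIT -(integral_indic P measurableT)//.
  apply: eq_integral => w _; congr _%:E; rewrite indicE.
  case: (boolP (w \in _)) => [|wA].
    rewrite inE => wA; apply: big1 => i iJ; rewrite fAE indicE mem_set//.
    exact: wA.
  apply/eqP; rewrite prodf_seq_eq0; apply/hasP.
  have [i [iJ wi]] : exists i, i \in J /\ ~ A i (X i w).
    apply: contrapT => /forallNP noti; move/negP: wA; apply; rewrite inE => i /= iJ.
    by apply: contrapT => nA; apply: (noti i).
  by exists i; rewrite ?mem_index_enum// iJ/= fAE indicE memNset.
have [kJ|kJ] := boolP (k \in J); last first.
  (* The factor at [k] does not occur in the product, so it may be replaced by the indicator of the
     whole line. *)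
  pose f' i := if i == k then \1_setT : R -> R else f i.
  have f'E i : i \in J -> f' i = f i.
    by rewrite /f'; case: eqP => // ->; rewrite (negbTE kJ).
  under eq_integral do (under eq_bigr => i iJ do rewrite -f'E//).
  under [RHS]eq_bigr => i iJ do rewrite -f'E//.
  apply: IH => i; rewrite /f'; case: eqVneq => // ik.
  - by rewrite integral_indic_RV// ltey_eq fin_num_measure//;
      exact: measurable_preimage_RV.
  - by move=> _; exists setT.
  - by move=> iks; apply: fA; rewrite inE negb_or ik.
(* With [f k] replaced by [\1_A], the induction hypothesis becomes the factorisation that
   [integral_mul_comp_indep] asks for, [Z] being the product of the other factors. *)
pose f' A i := if i == k then \1_A : R -> R else f i.
have IHf' A : measurable A -> \int[P]_w (\prod_(i in J) f' A i (X i w))%:E =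
    \prod_(i in J) \int[P]_w (f' A i (X i w))%:E.
  move=> mA; apply: IH => i; rewrite /f'; case: eqVneq => // ik.
  - rewrite integral_indic_RV// (le_lt_trans (probability_le1 _ _)) ?ltry//.
    by rewrite -[X in measurable X]setTI; exact: measurable_funPT.
  - by move=> _; exists A.
  - by move=> iks; apply: fA; rewrite inE negb_or ik.
have f'E A i : i != k -> f' A i = f i by rewrite /f'; case: eqP.
have f'k A : f' A k = \1_A by rewrite /f' eqxx.
have IHZ A : measurable A ->
    \int[P]_w ((\prod_(i in J | i != k) f i (X i w)) * \1_A (X k w))%:E =
    (\prod_(i in J | i != k) \int[P]_w (f i (X i w))%:E) * P (X k @^-1` A).
  move=> mA; have := IHf' A mA; rewrite (bigD1 k kJ)/= muleC.
  under [X in X * _]eq_bigr => i /andP[_ ik] do rewrite f'E//.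
  rewrite f'k integral_indic_RV// => <-; apply: eq_integral => w _.
  rewrite [in RHS](bigD1 k kJ)/= [in RHS]mulrC f'k; congr (_ * _)%:E.
  by apply: eq_bigr => i /andP[_ ik]; rewrite f'E.
have IZ : \int[P]_w (\prod_(i in J | i != k) f i (X i w))%:E =
    \prod_(i in J | i != k) \int[P]_w (f i (X i w))%:E.
  have := IHZ setT measurableT; rewrite preimage_setT probability_setT mule1 => <-.
  by apply: eq_integral => w _; rewrite indicT mulr1.
rewrite (bigD1 k kJ)/= muleC -IZ -integral_mul_comp_indep//.
- by apply: eq_integral => w _; rewrite [in LHS](bigD1 k kJ)/= mulrC.
- exact: mprod.
- by move=> w; apply: prodr_ge0.
- rewrite IZ ltey_eq prode_fin_num// => i _; rewrite ge0_fin_numE//.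
  by apply: integral_ge0 => w _; rewrite lee_fin.
- by move=> A mA; rewrite IHZ// IZ.
Qed.

End independence.

(** * The rate function and Chernoff's inequality *)

Lemma integral_same_law d1 d2 (T1 : measurableType d1) (T2 : measurableType d2)
    (R : realType) (P1 : probability T1 R) (P2 : probability T2 R)
    (X1 : {RV P1 >-> R}) (X2 : {RV P2 >-> R}) (f : R -> R) :
  same_law X1 X2 -> measurable_fun setT f -> (forall x, (0 <= f x)%R) ->
  \int[P1]_w (f (X1 w))%:E = \int[P2]_w (f (X2 w))%:E.
Proof.
move=> X12 mf f0.
have mEf : measurable_fun setT (EFin \o f) by exact/measurable_EFinP.
have f0E x : 0 <= (EFin \o f) x by rewrite lee_fin.
have := ge0_integral_distribution X1 mEf f0E.
have := ge0_integral_distribution X2 mEf f0E.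
rewrite /comp/= => <- <-; apply: eq_measure_integral => A mA _; exact: X12.
Qed.

Section rate_theory.
Context d (T : measurableType d) (R : realType) (P : probability T R).
Variable X : {RV P >-> R}.

Lemma mgfE s : 'M_P X s = \int[P]_w (expR (s * X w))%:E.
Proof.
rewrite /mmt_gen_fun unlock; apply: eq_integral => w _ /=.
by rewrite mulrC.
Qed.

Lemma measurable_expR_mul (s : R) : measurable_fun setT (fun x : R => expR (s * x)).
Proof. by apply: measurableT_comp => //; exact: measurable_funM. Qed.

Lemma mgf_ge0 s : 0 <= 'M_P X s.
Proof. by rewrite mgfE; apply: integral_ge0 => w _; rewrite lee_fin expR_ge0. Qed.

Lemma mgf0 : 'M_P X 0%R = 1.
Proof.
rewrite mgfE; under eq_integral do rewrite mul0r expR0.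
by rewrite integral_cst//= mul1e probability_setT.
Qed.

Lemma log_mgf0 : log_mgf X 0%R = 0.
Proof. by rewrite /log_mgf mgf0 lne1. Qed.

Lemma rate_ge0 t : 0 <= rate X t.
Proof. by apply: ereal_sup_ubound; exists 0%R => //; rewrite mul0r log_mgf0 sube0. Qed.

Lemma rate_inv_nd t t' : (t <= t')%R -> rate_inv X t <= rate_inv X t'.
Proof.
move=> tt'; apply: ereal_inf_le_tmp => _ [s [s0 st] <-]; exists s => //.
by split=> //; apply: le_trans st; rewrite lee_fin.
Qed.

Lemma rate_inv_ge0 t : 0 <= rate_inv X t.
Proof. by apply: le_ereal_inf_tmp => _ [s [s0 _] <-]; rewrite lee_fin. Qed.

Lemma rate_lt_of_lt_inv s t : (0 <= s)%R -> s%:E < rate_inv X t -> rate X s < t%:E.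
Proof.
move=> s0; rewrite !ltNge; apply: contra => st.
by apply: ereal_inf_lbound; exists s.
Qed.

Section symmetric.
Hypothesis symX : symmetric_RV X.

Lemma mgf_sym s : 'M_P X (- s)%R = 'M_P X s.
Proof.
rewrite !mgfE -(integral_same_law symX (measurable_expR_mul s)).
  by apply: eq_integral => w _ /=; rewrite mulNr mulrN.
by move=> x; exact: expR_ge0.
Qed.

(** By [1 + x <= expR x], the exponentials of [s * X] and [- s * X] add up to at least 2, and
    symmetry gives them the same expectation. *)
Lemma mgf_ge1 s : 1 <= 'M_P X s.
Proof.
have mE (t : R) : measurable_fun setT (fun w => (expR (t * X w))%:E).
  apply/measurable_EFinP; apply: (measurableT_comp (measurable_expR_mul t)).
  exact: measurable_funPT.
have : 1 + 1 <= 'M_P X s + 'M_P X (- s)%R.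
  rewrite !mgfE -ge0_integralD//.
  have -> : 1 + 1 = \int[P]_w (2%:E : \bar R).
    by rewrite integral_cst//= probability_setT mule1.
  apply: ge0_le_integral => //.
  - exact: emeasurable_funD.
  - move=> w _; rewrite -EFinD lee_fin.
    have := expR_ge1Dx (s * X w); have := expR_ge1Dx (- s * X w); lra.
rewrite mgf_sym; have := mgf_ge0 s; case: ('M_P X s) => [r| |]// _;
  last by move=> _; rewrite leey.
by rewrite -!EFinD !lee_fin; lra.
Qed.

Lemma log_mgf_ge0 s : 0 <= log_mgf X s.
Proof. by rewrite lne_ge0 mgf_ge1. Qed.

Lemma mgf_log_mgf s l : log_mgf X s = l%:E -> 'M_P X s = (expR l)%:E.
Proof.
move=> sl; rewrite -[LHS]lneK.
  by rewrite -/(log_mgf X s) sl.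
by rewrite in_itv/= mgf_ge0 leey.
Qed.

Lemma rate_nd t t' : (0 <= t)%R -> (t <= t')%R -> rate X t <= rate X t'.
Proof.
move=> t0 tt'; apply: ge_ereal_sup => _ [s _ <-].
have [s0|s0] := leP 0%R s.
  apply: (@le_trans _ _ ((s * t')%:E - log_mgf X s)).
    by apply: leeB => //; rewrite lee_fin ler_wpM2l.
  by apply: ereal_sup_ubound; exists s.
apply: le_trans (rate_ge0 t'); apply: (@le_trans _ _ (0 - log_mgf X s)).
  by apply: leeB => //; rewrite lee_fin nmulr_rle0.
by rewrite sub0e oppe_le0 log_mgf_ge0.
Qed.

(** Convexity combined with a zero at 0, obtained term by term: [log_mgf] is nonnegative, so
    [a * log_mgf X s <= log_mgf X s]. *)
Lemma rate_contraction (a t : R) : (0 <= a <= 1)%R ->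
  rate X (a * t) <= a%:E * rate X t.
Proof.
move=> /andP[a0 a1]; apply: ge_ereal_sup => _ [s _ <-].
apply: (@le_trans _ _ (a%:E * ((s * t)%:E - log_mgf X s))); last first.
  by apply: lee_wpmul2l; rewrite ?lee_fin//; apply: ereal_sup_ubound; exists s.
have := log_mgf_ge0 s; case: (log_mgf X s) => [l| |]//=; last by rewrite addeNy leNye.
rewrite lee_fin => l0; rewrite -EFinB -EFinM lee_fin.
by have := ler_piMl l0 a1; lra.
Qed.

(** Supplies Chernoff's parameter. A negative [s] or an infinite [log_mgf X s] gives a term that is
    at most 0, hence not above [c]. *)
Lemma rate_gtP (a c : R) : (0 <= a)%R -> (0 <= c)%R -> c%:E < rate X a ->
  exists s l : R, [/\ (0 <= s)%R, 'M_P X s = (expR l)%:E & (c < s * a - l)%R].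
Proof.
move=> a0 c0 /ereal_sup_gt[_ [s _ <-]] cs.
have := log_mgf_ge0 s; case E : (log_mgf X s) cs => [l| |] //= cs l0.
exists s, l; split; last by rewrite -lte_fin EFinB.
- rewrite leNgt; apply/negP => s0; move: cs l0; rewrite -EFinB lte_fin lee_fin.
  have : (s * a <= 0)%R by rewrite nmulr_rle0.
  lra.
- exact: mgf_log_mgf.
Qed.

Lemma prob_ge0_gt0 : 0 < P [set w | (0 <= X w)%R].
Proof.
rewrite lt0e measure_ge0 andbT; apply/negP => /eqP P0.
have m0 : measurable [set x : R | (0 <= x)%R].
  by rewrite -set_itvcy; exact: measurable_itv.
have P0' : P [set w | (X w <= 0)%R] = 0.
  rewrite -{}P0; have := symX m0; rewrite /distribution /pushforward /=.
  move=> <-; congr (P _); apply/seteqP; split => w /=; by rewrite oppr_ge0.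
have : P setT <= P [set w | (0 <= X w)%R] + P [set w | (X w <= 0)%R].
  have mle : measurable [set w | (X w <= 0)%R].
    apply: (measurable_preimage_RV X (A := [set x : R | (x <= 0)%R])).
    by rewrite -set_itvNyc; exact: measurable_itv.
  have mge : measurable [set w | (0 <= X w)%R] by exact: measurable_preimage_RV m0.
  rewrite (_ : setT = [set w | (0 <= X w)%R] `|` [set w | (X w <= 0)%R]).
    exact: measureU2.
  by apply/seteqP; split => w //= _; case: (leP 0%R (X w)) => [|/ltW]; [left|right].
by rewrite P0 P0' adde0 probability_setT lee_fin ler10.
Qed.

(** Almost surely [X < t], so ['M_P X u <= expR (u * t)] for [u > 0], and [rate X s] is at least
    [u * (s - t)], which is unbounded in [u]. *)
Lemma rate_eqy (t s : R) : (t < s)%R -> P [set w | (t <= X w)%R] = 0 ->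
  rate X s = +oo.
Proof.
move=> ts Pt0; apply/eqyP => A A0.
pose u := (A / (s - t))%R; have st : (0 < s - t)%R by rewrite subr_gt0.
have u0 : (0 < u)%R by rewrite divr_gt0.
apply: (@le_trans _ _ ((u * s)%:E - log_mgf X u)); last first.
  by apply: ereal_sup_ubound; exists u.
have Mu : 'M_P X u <= (expR (u * t))%:E.
  have -> : (expR (u * t))%:E = \int[P]_w (expR (u * t))%:E.
    by rewrite integral_cst//= probability_setT mule1.
  rewrite mgfE; apply: ae_ge0_le_integral => //.
    apply/measurable_EFinP; apply: (measurableT_comp (measurable_expR_mul u)).
    exact: measurable_funPT.
  exists [set w | (t <= X w)%R]; split => //.
    apply: (measurable_preimage_RV X (A := [set x : R | (t <= x)%R])).
    by rewrite -set_itvcy; exact: measurable_itv.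
  move=> w /= H; rewrite leNgt; apply/negP => Xt; apply: H => _.
  by rewrite lee_fin ler_expR ler_wpM2l// ltW.
have : log_mgf X u <= (u * t)%:E.
  rewrite -[leRHS]expeRK lee_lne ?in_itv/= ?mgf_ge0 ?leey//.
  by rewrite lee_fin expR_ge0.
have := log_mgf_ge0 u; case: (log_mgf X u) => [l| |]//= _; rewrite lee_fin => lt.
rewrite -EFinB lee_fin; have : (u * (s - t) = A)%R by rewrite /u divfK// gt_eqF.
lra.
Qed.

End symmetric.

(** A single [s] with finite [log_mgf X s = l] bounds [rate X a] below by [s * a - l], which reaches
    every level. The maximum in the witness keeps [a] nonnegative. *)
Lemma rate_inv_lty (delta t : R) : (0 < delta)%R ->
  (forall s : R, (`|s| < delta)%R -> log_mgf X s < +oo) -> symmetric_RV X ->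
  rate_inv X t < +oo.
Proof.
move=> delta0 fin symX; pose s := (delta / 2)%R.
have s0 : (0 < s)%R by rewrite divr_gt0.
have : log_mgf X s < +oo by apply: fin; rewrite gtr0_norm// /s; lra.
have := log_mgf_ge0 symX s; case E : (log_mgf X s) => [l| |]//; rewrite lee_fin => l0 _.
pose a := ((Num.max t 0 + l) / s)%R.
have a0 : (0 <= a)%R by rewrite divr_ge0 ?addr_ge0 ?le_max ?lexx ?orbT// ltW.
apply: (@le_lt_trans _ _ a%:E); last exact: ltry.
apply: ereal_inf_lbound; exists a => //; split => //.
apply: (@le_trans _ _ ((s * a)%:E - log_mgf X s)); last first.
  by apply: ereal_sup_ubound; exists s.
rewrite E -EFinB lee_fin /a mulrC divfK ?gt_eqF// addrK.
by rewrite le_max lexx.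
Qed.

End rate_theory.

Section chernoff.
Context d0 (T0 : measurableType d0) (R : realType) (P0 : probability T0 R).
Context d (T : measurableType d) (P : probability T R).
Variables (X : {RV P0 >-> R}) (I : finType) (Y : I -> {RV P >-> R}).
Hypothesis Y_indep : independent_RVs Y.
Hypothesis Y_law : forall i, same_law (Y i) X.
Hypothesis symX : symmetric_RV X.

Lemma measurable_sum_RV (J : {set I}) :
  measurable_fun setT (fun w => \sum_(i in J) Y i w : R)%R.
Proof.
rewrite (_ : (fun w => _) = fun w =>
    \sum_i (if i \in J then Y i w else 0))%R; last first.
  by apply/funext => w; exact: big_mkcond.
by apply: measurable_sum => i; case: (i \in J) => //; exact: measurable_funPT.
Qed.

Lemma measurable_sum_ge (J : {set I}) (b : R) :
  measurable [set w | (b <= \sum_(i in J) Y i w)%R].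
Proof.
rewrite -[A in measurable A]setTI.
rewrite -[A in _ `&` A](preimage_itvcy (fun w => \sum_(i in J) Y i w)%R).
by apply: measurable_sum_RV => //; exact: measurable_itv.
Qed.

(** Markov's inequality for the exponential of [s] times the sum, whose expectation splits into
    [#|J|] factors [expR l]. *)
Lemma chernoff_sum (J : {set I}) (s l b : R) : (0 <= s)%R ->
  'M_P0 X s = (expR l)%:E ->
  P [set w | (b <= \sum_(i in J) Y i w)%R] <= (expR (#|J|%:R * l - s * b))%:E.
Proof.
move=> s0 sl.
have Ys i : \int[P]_w (expR (s * Y i w))%:E = (expR l)%:E.
  rewrite -sl mgfE; apply: (integral_same_law (Y_law i) (measurable_expR_mul s)).
  by move=> x; exact: expR_ge0.
have mexp : measurable_fun setT (fun w => expR (s * (\sum_(i in J) Y i w)) : R)%R.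
  exact: (measurableT_comp (measurable_expR_mul s) (measurable_sum_RV J)).
rewrite -[A in P A <= _]setIT -(integral_indic P measurableT);
  last exact: measurable_sum_ge.
apply: (@le_trans _ _ (\int[P]_w ((expR (- (s * b)))%:E *
    (expR (s * \sum_(i in J) Y i w))%:E))).
  apply: ge0_le_integral => //.
  - by apply/measurable_EFinP/measurable_indic; exact: measurable_sum_ge.
  - by apply/measurable_EFinP; exact: measurable_funM.
  move=> w _; rewrite -EFinM -expRD lee_fin indicE.
  case: (boolP (w \in _)); last by rewrite expR_ge0.
  rewrite inE/= => bw; rewrite -[leLHS]expR0 ler_expR.
  by have := ler_wpM2l s0 bw; lra.
rewrite ge0_integralZl_EFin ?expR_ge0//; last exact/measurable_EFinP.
under eq_integral do rewrite mulr_sumr expR_sum.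
rewrite (integral_prod_indep (f := fun _ x => expR (s * x)) J Y_indep)//.
- under eq_bigr do rewrite Ys.
  rewrite prodEFin big_const -EFinM lee_fin.
  have -> : iter #|J| ( *%R (expR l)) 1%R = expR (#|J|%:R * l).
    by rewrite expRM_natl -Monoid.iteropE.
  by rewrite -expRD addrC.
- by move=> i; exact: measurable_expR_mul.
- by move=> i; rewrite Ys ltry.
Qed.

Lemma prob_sum_gt_rate_inv (J : {set I}) (n : nat) (L : R) : (1 < n)%N -> #|J| = n ->
  rate_inv X (ln n%:R) = L%:E ->
  P [set w | (n%:R * L < \sum_(i in J) Y i w)%R] <= (expR (- (n%:R * ln n%:R)))%:E.
Proof.
move=> n1 cJ nL.
have n0 : (0 < n%:R :> R)%R by rewrite ltr0n (ltn_trans _ n1).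
have lnn : (0 < ln n%:R :> R)%R by rewrite ln_gt0// ltr1n.
have L0 : (0 <= L)%R by rewrite -lee_fin -nL rate_inv_ge0.
(* [rate X L] may be smaller than [ln n], since [rate X] can jump at [L]:
   Chernoff's inequality is applied at every [a > L] and passes to the limit. *)
have above a : (L < a)%R ->
    P [set w | (n%:R * a <= \sum_(i in J) Y i w)%R] <= (expR (- (n%:R * ln n%:R)))%:E.
  move=> La; have ra : (ln n%:R)%:E <= rate X a.
    have /ereal_inf_lt[_ [s [s0 rs] <-]] : rate_inv X (ln n%:R) < a%:E.
      by rewrite nL lte_fin.
    by rewrite lte_fin => /ltW sa; apply: le_trans rs _; exact: rate_nd.
  (* The supremum defining [rate X a] need not be attained, so Chernoff's inequality is used for
     each [c] below [ln n], and the limit is taken afterwards. *)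
  have bound c : (0 <= c)%R -> (c < ln n%:R)%R ->
      P [set w | (n%:R * a <= \sum_(i in J) Y i w)%R] <= (expR (- (n%:R * c)))%:E.
    move=> c0 cn; have a0 : (0 <= a)%R by apply: ltW; exact: le_lt_trans L0 La.
    have [|s [l [s0 sl cs]]] := rate_gtP symX a0 c0.
      by apply: lt_le_trans ra; rewrite lte_fin.
    apply: le_trans (chernoff_sum _ _ s0 sl) _.
    rewrite cJ lee_fin ler_expR.
    by have := ltW cs; rewrite -(ler_pM2l n0); lra.
  have Pfin : P [set w | (n%:R * a <= \sum_(i in J) Y i w)%R] \is a fin_num.
    by rewrite fin_num_measure//; exact: measurable_sum_ge.
  rewrite -(fineK Pfin) lee_fin leNgt; apply/negP => lt.
  set p := fine _ in lt.
  have p0 : (0 < p)%R by apply: le_lt_trans lt; exact: expR_ge0.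
  have p1 : (- ln p < n%:R * ln n%:R)%R.
    by rewrite ltrNl -ltr_expR (lnK p0).
  (* If the probability [p] exceeded [n^-n], any [c] between [- ln p / n] and [ln n] would
     contradict [bound]. The maximum with 0 keeps [c] nonnegative. *)
  pose m := Num.max 0%R (- ln p / n%:R)%R.
  have mn : (m < ln n%:R)%R by rewrite /m gt_max lnn ltr_pdivrMr// mulrC.
  have [c mc cn] : exists2 c, (m < c)%R & (c < ln n%:R)%R.
    by exists ((m + ln n%:R) / 2)%R; lra.
  have c0 : (0 <= c)%R.
    by apply: ltW; apply: le_lt_trans mc; rewrite le_max lexx.
  suff : (expR (- (n%:R * c)) < p)%R.
    by apply/negP; rewrite -leNgt -lee_fin /p (fineK Pfin); exact: bound.
  rewrite -[ltRHS](lnK p0) ltr_expR ltrNl.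
  by move: mc; rewrite /m gt_max => /andP[_]; rewrite ltr_pdivrMr// mulrC.
pose F (k : nat) := [set w | (n%:R * (L + k.+1%:R^-1) <= \sum_(i in J) Y i w)%R].
have mF k : measurable (F k) by exact: measurable_sum_ge.
have -> : [set w | (n%:R * L < \sum_(i in J) Y i w)%R] = \bigcup_k F k.
  apply/seteqP; split => w /=; last first.
    move=> [k _] /=; apply: lt_le_trans; rewrite ltr_pM2l// ltrDl invr_gt0.
    by rewrite ltr0n.
  rewrite mulrC -ltr_pdivlMr// => /ltr_add_invr[k kw].
  by exists k => //; rewrite /F/= mulrC -ler_pdivlMr// ltW.
apply: (cvge_le _ (nondecreasing_cvg_mu mF _ _)).
- by apply: nearW => k; apply: above; rewrite ltrDl invr_gt0 ltr0n.
- exact: bigcup_measurable.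
- move=> k k' kk'; apply/subsetPset => w; apply: le_trans.
  by rewrite ler_pM2l// lerD2l lef_pV2 ?posrE ?ltr0n// ler_nat.
Qed.

End chernoff.

(** * Lower tails of good random variables *)

(** Includes [n = 0], where [ln] takes the default value 0. *)
Lemma le_ln_nat (R : realType) (n m : nat) : (n <= m)%N -> (ln n%:R <= ln m%:R :> R)%R.
Proof.
case: n => [_|n nm]; last by rewrite ler_ln ?posrE ?ltr0n ?ler_nat// (leq_trans _ nm).
by rewrite ln0//; case: m => [|m]; [rewrite ln0|rewrite ln_ge0 ?ler1n].
Qed.

Lemma near_le_ln_nat (R : realType) (K : R) : \forall n \near \oo, (K <= ln n%:R)%R.
Proof.
have : \forall n \near \oo, (expR K <= n%:R)%R by exact: nbhs_infty_ger.
apply: filterS => n Kn; rewrite -[K]expRK ler_ln ?posrE ?expR_gt0//.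
exact: lt_le_trans (expR_gt0 K) Kn.
Qed.

Section lower_tail.
Context d (T : measurableType d) (R : realType) (P : probability T R).
Variable X : {RV P >-> R}.
Hypothesis goodX : good_RV X.

Lemma rate_inv_fin t : rate_inv X t \is a fin_num.
Proof.
have [symX [delta delta0 fin] _] := goodX.
by rewrite ge0_fin_numE ?rate_inv_ge0//; exact: (rate_inv_lty _ delta0).
Qed.

Let l (n : nat) : R := fine (rate_inv X (ln n%:R)).

Let lE n : rate_inv X (ln n%:R) = (l n)%:E.
Proof. by rewrite fineK// rate_inv_fin. Qed.

Let l_nd n m : (n <= m)%N -> (l n <= l m)%R.
Proof. by move=> nm; rewrite -lee_fin -!lE rate_inv_nd// le_ln_nat. Qed.

Let l_ge0 n : (0 <= l n)%R.
Proof. by rewrite -lee_fin -lE rate_inv_ge0. Qed.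

Let prob_ge (t : R) := P [set w | (t <= X w)%R].

Let measurable_ge (t : R) : measurable [set w | (t <= X w)%R].
Proof.
apply: (measurable_preimage_RV X (A := [set x : R | (t <= x)%R])).
by rewrite -set_itvcy; exact: measurable_itv.
Qed.

Let prob_ge_le (t t' : R) : (t <= t')%R -> prob_ge t' <= prob_ge t.
Proof.
move=> tt'; apply: le_measure; rewrite ?inE; [exact: measurable_ge..|].
by move=> w; exact: le_trans.
Qed.

(** Multiplied by [n], the lower bound becomes [n^c], which outgrows [ln n]; this is what the union
    bound over empty rectangles asks for. *)
Lemma lower_tail (e : R) : (0 < e < 1)%R ->
  exists2 c : R, (0 < c)%R & \forall n \near \oo,
    (expR ((c - 1) * ln n%:R))%:E <=
      P [set w | ((1 - e) * fine (rate_inv X (ln n%:R)) <= X w)%R].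
Proof.
move=> /andP[e0 e1]; have [symX _ [h h0 tailX]] := goodX.
rewrite -/(l _) -/(prob_ge _).
have [[K lK]|unbounded] := pselect (exists K, forall n, (l n <= K)%R).
  exists (1 / 2)%R; first lra.
  have sup_l : has_sup (range l).
    by split; [exists (l 0%N), 0%N|exists K => _ [n _ <-]].
  pose k := sup (range l).
  have lk n : (l n <= k)%R by apply: ub_le_sup; [case: sup_l|exists n].
  have k0 : (0 <= k)%R by exact: le_trans (l_ge0 0%N) (lk 0%N).
  have : 0 < prob_ge ((1 - e) * k).
    rewrite lt0e measure_ge0 andbT; apply/negP => /eqP pk.
    (* If the probability vanished, [rate X] would be infinite to the right of [(1 - e) * k], so
       every [l n] would be at most [(1 - e) * k]. This forces [k = 0], against [prob_ge0_gt0]. *)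
    have kt : (k <= (1 - e) * k)%R.
      apply/ler_addgt0Pr => eta eta0.
      apply: ge_sup => [|_ [n _ <-]]; first by exists (l 0%N), 0%N.
      rewrite -lee_fin -lE; apply: ereal_inf_lbound; exists ((1 - e) * k + eta)%R => //.
      split; first by apply: addr_ge0; [apply: mulr_ge0 => //;
        rewrite subr_ge0|]; exact: ltW.
      by rewrite (rate_eqy symX _ pk) ?leey// ltrDl.
    have k_eq0 : k = 0%R by have := mulr_ge0 (ltW e0) k0; nra.
    have := prob_ge0_gt0 symX; have := pk.
    by rewrite /prob_ge k_eq0 mulr0 => ->; rewrite ltxx.
  have pfin : prob_ge ((1 - e) * k) \is a fin_num by rewrite fin_num_measure.
  rewrite -(fineK pfin) lte_fin; set p := fine _ => p0.
  (* For [c = 1/2] the left-hand side is [n^(-1/2)], which is at most [p] once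
     [ln n >= - 2 * ln p]. *)
  have := near_le_ln_nat (- 2 * ln p)%R; apply: filterS => n pn.
  apply: (@le_trans _ _ (prob_ge ((1 - e) * k))); last first.
    by apply: prob_ge_le; apply: ler_wpM2l; [rewrite subr_ge0 ltW|exact: lk].
  rewrite -(fineK pfin) lee_fin -/p -[leRHS](lnK p0) ler_expR; lra.
(* One factor [1 - a] moves the point strictly below [l n], where [rate X] is less than [ln n]; a
   second one shrinks the rate by [1 - a]. With the tail error [1 + a] the exponent is
   [(1 + a) * (1 - a) = 1 - a * a], while [(1 - a) ^+ 2 >= 1 - e]. *)
pose a := (e / 2)%R; have a0 : (0 < a)%R by rewrite /a; lra.
have a1 : (a < 1)%R by rewrite /a; lra.
exists (a * a)%R; first by rewrite mulr_gt0.
have [M [_ HM]] : \forall t \near +oo%R, (`|h t| <= a)%R /\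
    P [set w | (t < X w)%R] = expeR (- ((1 + h t)%:E * rate X t)).
  apply: filterI => //.
  by have /cvgr0_norm_le := h0; apply.
(* As [l] is nondecreasing, from [N] on the point [(1 - a) * (1 - a) * l n] exceeds both 0 and the
   threshold [M] of the tail estimate. *)
have [N lN] : exists N, (Num.max M 0 / ((1 - a) * (1 - a)) < l N)%R.
  apply: contrapT => /forallNP lM; apply: unbounded.
  by exists (Num.max M 0 / ((1 - a) * (1 - a)))%R => n; rewrite leNgt; exact/negP.
exists N => // n /= Nn; set t := ((1 - a) * ((1 - a) * l n))%R.
have aa : (0 < (1 - a) * (1 - a))%R by rewrite mulr_gt0// subr_gt0.
have {lN} : (Num.max M 0 / ((1 - a) * (1 - a)) < l n)%R.
  exact: lt_le_trans lN (l_nd Nn).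
rewrite ltr_pdivrMr// mulrC -mulrA -/t gt_max => /andP[Mt t0].
have ln0 : (0 < l n)%R.
  rewrite lt_neqAle l_ge0 andbT; apply/eqP => ln0.
  by move: t0; rewrite /t -ln0 !mulr0 ltxx.
have [ht tailt] := HM _ Mt.
have rs : rate X ((1 - a) * l n) < (ln n%:R)%:E.
  apply: rate_lt_of_lt_inv; first by rewrite mulr_ge0// subr_ge0 ltW.
  by rewrite lE lte_fin gtr_pMl// ltrBlDr ltrDl.
have : rate X t <= ((1 - a) * ln n%:R)%:E.
  apply: (@le_trans _ _ ((1 - a)%:E * rate X ((1 - a) * l n))).
    by apply: rate_contraction => //; lra.
  by rewrite EFinM; apply: lee_wpmul2l; rewrite ?lee_fin ?subr_ge0 ltW.
have := rate_ge0 X t; move: tailt; case: (rate X t) => [r| |]// tailt.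
rewrite !lee_fin => r0 rn.
apply: (@le_trans _ _ (P [set w | (t < X w)%R])).
  rewrite tailt -EFinM /= lee_fin ler_expR.
  have : ((1 + h t) * r <= (1 + a) * r)%R.
    by apply: ler_wpM2r => //; rewrite lerD2l (le_trans _ ht)// ler_norm.
  have : ((1 + a) * r <= (1 + a) * ((1 - a) * ln n%:R))%R.
    by apply: ler_wpM2l => //; lra.
  lra.
apply: le_measure; rewrite ?inE.
- apply: (measurable_preimage_RV X (A := [set x : R | (t < x)%R])).
  by rewrite -set_itvoy; exact: measurable_itv.
- exact: measurable_ge.
move=> w /= /ltW; apply: le_trans; rewrite /t mulrA; apply: ler_wpM2r; first exact: l_ge0.
have ea : (e = 2 * a)%R by rewrite /a; lra.
have := mulr_ge0 (ltW a0) (ltW a0); rewrite ea; lra.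
Qed.

End lower_tail.

Lemma union_bound d (T : measurableType d) (R : realType) (P : probability T R)
    (I : finType) (Q : pred I) (A : set T) (F : I -> set T) :
  measurable A -> (forall i, Q i -> measurable (F i)) ->
  (forall w, A w -> exists2 i, Q i & F i w) ->
  P A <= \sum_(i | Q i) P (F i).
Proof.
move=> mA mF AF; pose B := \big[setU/set0]_(i | Q i) F i.
have [mB PB] : measurable B /\ P B <= \sum_(i | Q i) P (F i).
  apply: (big_ind2 (fun B r => measurable B /\ P B <= r)) => [|B1 r1 B2 r2|i Qi].
  - by rewrite measure0.
  - move=> [mB1 PB1] [mB2 PB2]; split; first exact: measurableU.
    exact: le_trans (measureU2 _ mB1 mB2) (leeD PB1 PB2).
  - by split=> //; exact: mF.
apply: le_trans PB; apply: le_measure; rewrite ?inE// => w /AF[i Qi Fiw].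
by rewrite /B (bigD1 i)//=; left.
Qed.

(** * The maximal weight of a perfect matching *)

Lemma leq_bin_exp n m : ('C(n, m) <= n ^ m)%N.
Proof.
apply: (@leq_trans (n ^_ m)).
  by rewrite -bin_ffact leq_pmulr ?fact_gt0.
elim: m => [|m IH]; first by rewrite ffactn0.
by rewrite ffactnSr expnSr leq_mul// leq_subr.
Qed.

(** By symmetry ['C(n, b)] equals ['C(n, a - 1)], so the product is at most [n^(2a - 1)]. For
    [a = 0] it vanishes, since then [b = n.+1]. *)
Lemma leq_bin_mul_bin n a b : (a + b = n.+1)%N -> (a <= b)%N ->
  ('C(n, a) * 'C(n, b) <= (n ^ 2) ^ a)%N.
Proof.
case: a => [|a] abn ab; first by rewrite (@bin_small n b) ?muln0//; lia.
rewrite -(@bin_sub n b); last lia.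
have -> : (n - b = a)%N by lia.
rewrite -expnM (_ : 2 * a.+1 = a.+1 + a.+1)%N ?expnD; last lia.
apply: leq_mul; first exact: leq_bin_exp.
by apply: leq_trans (leq_bin_exp _ _) _; rewrite leq_pexp2l//; lia.
Qed.

(** The exponent is one less than the base, which leaves the factor [1 / n] in the union bound over
    matchings. *)
Lemma leq_fact_exp n : (n.+1`! <= n.+1 ^ n)%N.
Proof.
elim: n => // n IH; rewrite factS expnS leq_mul//.
by apply: leq_trans IH _; case: n => // n; rewrite leq_exp2r.
Qed.

(** Let [a] be the smaller side and [y] the right-hand side. The binomials give at most [n^(2a)] and
    [b >= n / 2], so for [a > 0] the term is at most [y ^+ a], hence at most [y]. *)
Lemma hole_term_le (R : realType) (n a b : nat) (p : R) :
  (a + b = n.+1)%N -> (0 <= p)%R ->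
  (n%:R ^+ 2 * expR (- (p * n%:R / 2)) <= 1)%R ->
  ('C(n, a)%:R * ('C(n, b)%:R * expR (- (p * (a * b)%:R))) <=
    n%:R ^+ 2 * expR (- (p * n%:R / 2)))%R.
Proof.
wlog ab : a b / (a <= b)%N => [H abn|].
  have [ab|ba] := leqP a b; first exact: H.
  move=> p0 y1; rewrite mulrCA (mulnC a).
  by apply: H => //; [exact: ltnW|rewrite addnC].
move=> abn p0; set y := (X in (X <= 1)%R) => y1.
have y0 : (0 <= y)%R by rewrite mulr_ge0 ?expR_ge0// exprn_ge0.
have [a0|a_gt0] := posnP a.
  by rewrite (@bin_small n b) ?mul0r ?mulr0//; lia.
rewrite mulrA -natrM; apply: (@le_trans _ _ (y ^+ a)%R); last first.
  by rewrite -(prednK a_gt0) exprS ler_piMr// exprn_ile1.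
rewrite /y exprMn -natrX -natrX -expRM_natl; apply: ler_pM => //.
- by rewrite ler_nat; exact: leq_bin_mul_bin.
rewrite ler_expR natrM mulrN lerN2.
have : (n%:R <= 2 * b%:R :> R)%R by rewrite -natrM ler_nat; lia.
have : (0 <= p * a%:R)%R by rewrite mulr_ge0.
by move=> pa /(ler_wpM2l pa); lra.
Qed.

Lemma sum_card_eq (R : pzRingType) (n k : nat) (x : R) :
  (\sum_(A : {set 'I_n} | #|A| == k) x = 'C(n, k)%:R * x)%R.
Proof.
have <- : #|[set A : {set 'I_n} | #|A| == k]%SET| = 'C(n, k).
  by rewrite card_draws card_ord.
by rewrite mulr_natl -sumr_const; apply: eq_bigl => A; rewrite inE.
Qed.

Section max_matching.
Context d0 (T0 : measurableType d0) (R : realType) (P0 : probability T0 R).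
Context d (T : measurableType d) (P : probability T R).
Variables (X : {RV P0 >-> R}) (n : nat) (Y : 'I_n * 'I_n -> {RV P >-> R}).
Hypothesis Y_indep : independent_RVs Y.
Hypothesis Y_law : forall e, same_law (Y e) X.

Let W w := max_matching_weight (fun e => Y e w).
Let matchings := [set M | perfect_matching (complete_bipartite n) M]%SET.

Lemma max_matching_geP (x : 'I_n * 'I_n -> R) (c : R) :
  reflect (exists2 M, M \in matchings & (c <= \sum_(e in M) x e)%R)
    (c%:E <= max_matching_weight x).
Proof.
apply: (iffP (bigmax_geP _ _ _ _)) => [[//|[M pM cM]]|[M pM cM]].
  by exists M; rewrite ?inE// -lee_fin.
by right; exists M; rewrite ?lee_fin//; move: pM; rewrite inE.
Qed.

Lemma max_matching_gtP (x : 'I_n * 'I_n -> R) (c : R) :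
  reflect (exists2 M, M \in matchings & (c < \sum_(e in M) x e)%R)
    (c%:E < max_matching_weight x).
Proof.
apply: (iffP (bigmax_gtP _ _ _ _)) => [[//|[M pM cM]]|[M pM cM]].
  by exists M; rewrite ?inE// -lte_fin.
by right; exists M; rewrite ?lte_fin//; move: pM; rewrite inE.
Qed.

Lemma measurable_sum_gt (J : {set 'I_n * 'I_n}) (b : R) :
  measurable [set w | (b < \sum_(i in J) Y i w)%R].
Proof.
rewrite -[A in measurable A]setTI.
rewrite -[A in _ `&` A](preimage_itvoy (fun w => \sum_(i in J) Y i w)%R).
by apply: measurable_sum_RV => //; exact: measurable_itv.
Qed.

Lemma measurable_max_matching_ge (c : R) : measurable [set w | c%:E <= W w].
Proof.
rewrite (_ : [set w | _] = \bigcup_(M in [set` matchings])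
    [set w | (c <= \sum_(e in M) Y e w)%R]).
  by apply: fin_bigcup_measurable => // M _; exact: measurable_sum_ge.
by apply/seteqP; split => w => [/max_matching_geP[M]|[M MM ?]];
  [exists M|apply/max_matching_geP; exists M].
Qed.

Lemma measurable_max_matching_gt (c : R) : measurable [set w | c%:E < W w].
Proof.
rewrite (_ : [set w | _] = \bigcup_(M in [set` matchings])
    [set w | (c < \sum_(e in M) Y e w)%R]).
  by apply: fin_bigcup_measurable => // M _; exact: measurable_sum_gt.
by apply/seteqP; split => w => [/max_matching_gtP[M]|[M MM ?]];
  [exists M|apply/max_matching_gtP; exists M].
Qed.

Lemma prob_max_matching_gt (L : R) : symmetric_RV X -> (1 < n)%N ->
  rate_inv X (ln n%:R) = L%:E ->
  P [set w | (n%:R * L)%:E < W w] <= n%:R^-1%:E.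
Proof.
move=> symX n1 nL; have n0 : (0 < n)%N by exact: ltn_trans n1.
apply: (@le_trans _ _ (\sum_(M in matchings) (expR (- (n%:R * ln n%:R)))%:E)).
  apply: (@le_trans _ _ (\sum_(M in matchings)
      P [set w | (n%:R * L < \sum_(e in M) Y e w)%R])).
    apply: union_bound; first exact: measurable_max_matching_gt.
    - by move=> M _; exact: measurable_sum_gt.
    - by move=> w /max_matching_gtP.
  apply: lee_sum => M; rewrite inE => /card_perfect_matching cM.
  exact: (prob_sum_gt_rate_inv Y_indep Y_law symX n1 cM nL).
(* Here [expR (- (n * ln n))] is [n^-n]; cancelling one factor [n] reduces the claim to a bound of
   the number of matchings by [n ^ n.-1]. *)
rewrite sumEFin lee_fin sumr_const expRN expRM_natl lnK ?posrE ?ltr0n//.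
rewrite -[leLHS]mulr_natr mulrC ler_pdivrMr ?exprn_gt0 ?ltr0n//.
rewrite -[k in (_ ^+ k)%R](prednK n0) exprS mulKf ?pnatr_eq0 -?lt0n//.
rewrite -natrX ler_nat; apply: leq_trans (card_perfect_matchings _) _.
by have := leq_fact_exp n.-1; rewrite (prednK n0).
Qed.

(** A perfect matching whose weights are all at least [t] would weigh at least [n * t], so the edges
    of weight at least [t] contain none. *)
Lemma max_matching_lt_hole (t : R) w : W w < (n%:R * t)%:E ->
  exists A B : {set 'I_n}, (#|A| + #|B|)%N = n.+1 /\
    forall e, e \in finset.setX A B -> (Y e w < t)%R.
Proof.
move=> Wt.
have [[M ME]|[A [B [AB hole]]]] :=
    perfect_matching_or_hole [set e | (t <= Y e w)%R]%SET; last first.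
  by exists A, B; split=> // e /hole; rewrite inE -ltNge.
move: Wt; rewrite ltNge => /negP[]; apply/max_matching_geP; exists M.
  rewrite inE; case/and3P: ME => _ rowM colM; apply/and3P; split=> //.
  exact: finset.subsetT.
have -> : (n%:R * t)%R = (\sum_(e in M) t)%R.
  by rewrite sumr_const (card_perfect_matching ME) mulr_natl.
apply: ler_sum => e eM; case/and3P: ME => /fintype.subsetP ME _ _.
by have := ME _ eM; rewrite inE.
Qed.

(** Independence gives [(1 - p) ^+ (#|A| * #|B|)], and [1 - p <= expR (- p)]. *)
Lemma prob_hole (t p : R) (A B : {set 'I_n}) :
  P0 [set w | (t <= X w)%R] = p%:E ->
  P (\bigcap_(e in [set` finset.setX A B]) (Y e @^-1` [set x | (x < t)%R])) <=
    (expR (- (p * (#|A| * #|B|)%:R)))%:E.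
Proof.
move=> Xp; have mlt : measurable [set x : R | (x < t)%R].
  by rewrite -set_itvNyo; exact: measurable_itv.
have Xq : P0 (X @^-1` [set x | (x < t)%R]) = (1 - p)%:E.
  rewrite EFinB -Xp -probability_setC.
    by congr (P0 _); apply/seteqP; split => w /=; rewrite ltNge => /negP.
  apply: (measurable_preimage_RV X (A := [set x : R | (t <= x)%R])).
  by rewrite -set_itvcy; exact: measurable_itv.
have p1 : (0 <= 1 - p)%R by rewrite -lee_fin -Xq measure_ge0.
rewrite Y_indep//; under eq_bigr => e _ do
  rewrite [P _](Y_law e mlt) [distribution _ _ _]Xq.
rewrite prodEFin lee_fin prodr_const cardsX -mulNr mulrC expRM_natl.
apply: lerXn2r; rewrite ?nnegrE ?expR_ge0//; have := expR_ge1Dx (- p); lra.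
Qed.

(** The holes are grouped by [#|A|]: each of the [n.+1] sizes contributes at most [y], whose product
    with [n^3] is at most 1. *)
Lemma prob_max_matching_lt (t p : R) : (1 < n)%N ->
  P0 [set w | (t <= X w)%R] = p%:E -> (10 * ln n%:R <= p * n%:R)%R ->
  P [set w | W w < (n%:R * t)%:E] <= n%:R^-1%:E.
Proof.
move=> n1 Xp pn; have n0 : (0 < n)%N by exact: ltn_trans n1.
have n0R : (0 < n%:R :> R)%R by rewrite ltr0n.
have p0 : (0 <= p)%R by rewrite -lee_fin -Xp measure_ge0.
have mlt : measurable [set x : R | (x < t)%R].
  by rewrite -set_itvNyo; exact: measurable_itv.
pose F (i : 'I_n.+1 * ({set 'I_n} * {set 'I_n})) :=
  \bigcap_(e in [set` finset.setX i.2.1 i.2.2]) (Y e @^-1` [set x | (x < t)%R]).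
pose Q (i : 'I_n.+1 * ({set 'I_n} * {set 'I_n})) :=
  (#|i.2.1| == i.1) && (#|i.2.2| == n.+1 - i.1)%N.
apply: (@le_trans _ _ (\sum_(i | Q i) P (F i))).
  apply: union_bound.
  - rewrite (_ : [set w | _] = ~` [set w | (n%:R * t)%:E <= W w]).
      by apply: measurableC; exact: measurable_max_matching_ge.
    by apply/seteqP; split => w /=; rewrite ltNge => /negP.
  - move=> i _; apply: fin_bigcap_measurable => // e _.
    exact: measurable_preimage_RV.
  - move=> w /max_matching_lt_hole[A [B [AB hole]]].
    have An : (#|A| < n.+1)%N by rewrite ltnS -[leqRHS]card_ord max_card.
    exists (Ordinal An, (A, B)); last by move=> e; exact: hole.
    by rewrite /Q/= -AB addKn !eqxx.
pose f (i : 'I_n.+1) := expR (- (p * (i * (n.+1 - i))%:R)) : R.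
apply: (@le_trans _ _ (\sum_(i | Q i) (f i.1)%:E)).
  apply: lee_sum => -[a [A B]] /andP[/= /eqP Aa /eqP Bb].
  by apply: le_trans (prob_hole A B Xp) _; rewrite Aa Bb.
rewrite sumEFin lee_fin.
pose y := (n%:R ^+ 2 * expR (- (p * n%:R / 2)))%R : R.
(* The constant 10 comes from here: [n^2 * n^3] is [expR (5 * ln n)], and
   [5 * ln n <= p * n / 2]. *)
have y3 : (y * n%:R ^+ 3 <= 1)%R.
  have nexp : n%:R = expR (ln n%:R) :> R by rewrite lnK.
  rewrite /y mulrAC -exprD nexp -expRM_natl -expRD -[leRHS]expR0 ler_expR -nexp.
  by rewrite natrD; lra.
have y0 : (0 <= y)%R by rewrite mulr_ge0 ?expR_ge0// exprn_ge0.
have n3 : (1 <= n%:R ^+ 3 :> R)%R by rewrite exprn_ege1// ler1n.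
have y1 : (y <= 1)%R by apply: le_trans y3; rewrite ler_peMr.
apply: (@le_trans _ _ (\sum_(a < n.+1) y)%R).
  rewrite -(pair_big_dep xpredT (fun (a : 'I_n.+1) (AB : {set 'I_n} * {set 'I_n}) =>
    (#|AB.1| == a) && (#|AB.2| == n.+1 - a)%N) (fun a _ => f a))/=.
  apply: ler_sum => a _.
  rewrite -(pair_big_dep (fun A : {set 'I_n} => #|A| == a)
    (fun _ (B : {set 'I_n}) => #|B| == n.+1 - a)%N (fun _ _ => f a))/=.
  under eq_bigr do rewrite sum_card_eq.
  rewrite sum_card_eq; apply: hole_term_le => //.
  by rewrite subnKC// ltnW.
(* The total [n.+1 * y] is at most [1 / n] because [n.+1 * n <= n^3] for [n >= 2]. *)
rewrite sumr_const card_ord -[leLHS]mulr_natr -[leRHS]mul1r ler_pdivlMr//.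
apply: le_trans y3; rewrite -mulrA; apply: ler_wpM2l => //.
by rewrite -natrM -natrX ler_nat !expnS expn0 muln1; nia.
Qed.

End max_matching.

(** * Concentration of the maximal weight *)

(** For large [n], [eps n] is [r k] for the largest [k <= n] such that [Q n (r k)] holds. Every
    fixed [k] qualifies eventually, so the chosen [k] tends to infinity. *)
Lemma diagonal_sequence (R : realType) (Q : nat -> R -> Prop) :
  (forall e : R, (0 < e < 1)%R -> \forall n \near \oo, Q n e) ->
  exists2 eps : nat -> R, eps n @[n --> \oo] --> (0 : R)%R &
    \forall n \near \oo, Q n (eps n).
Proof.
move=> HQ; pose r (k : nat) : R := (k.+2%:R^-1)%R.
have r01 k : (0 < r k < 1)%R.
  by rewrite invr_gt0 ltr0n/= invf_lt1 ?ltr0n// ltr1n.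
pose A n := [pred k : 'I_n.+1 | `[< Q n (r k) >]].
pose K n : nat := \max_(k in A n) k.
have KQ k : \forall n \near \oo, (k <= K n)%N /\ Q n (r (K n)).
  have : \forall n \near \oo, Q n (r k) /\ (k <= n)%N.
    by apply: filterI; [exact: HQ|exact: nbhs_infty_ge].
  apply: filterS => n [Qk kn].
  have kA : Ordinal (kn : (k < n.+1)%N) \in A n by rewrite unfold_in /=; exact: asboolT.
  split; first exact: (leq_bigmax_cond (Ordinal (kn : (k < n.+1)%N)) kA).
  have [|i iA Ki] := @eq_bigmax_cond _ (A n) (@nat_of_ord n.+1).
    by apply/card_gt0P; exists (Ordinal (kn : (k < n.+1)%N)).
  by rewrite /K Ki; move: iA; rewrite unfold_in => /asboolP.
exists (fun n => r (K n)); last by apply: filterS (KQ 0%N) => n [_ Qn].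
apply/cvgr0Pnorm_le => e e0.
have [k ke] : exists k, (0 + k.+1%:R^-1 < e)%R by exact: ltr_add_invr.
have := KQ k; apply: filterS => n [kK _].
have /andP[r0 _] := r01 (K n).
rewrite gtr0_norm//; apply: ltW; apply: le_lt_trans ke.
by rewrite add0r lef_pV2 ?posrE ?ltr0n// ler_nat; lia.
Qed.

Theorem theorem1 (R : realType)
    (d0 : measure_display) (T0 : measurableType d0) (P0 : probability T0 R)
    (X : {RV P0 >-> R}) (X_good : good_RV X)
    (d : nat -> measure_display) (T : forall n : nat, measurableType (d n))
    (P : forall n : nat, probability (T n) R)
    (Y : forall n : nat, 'I_n * 'I_n -> {RV (P n) >-> R})
    (Y_indep : forall n : nat, independent_RVs (Y n))
    (Y_law : forall (n : nat) (e : 'I_n * 'I_n), same_law (Y n e) X) :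
  exists2 eps : nat -> R, eps n @[n --> \oo] --> (0 : R)%R &
    P n [set w |
           ((1 - eps n) * n%:R)%:E * rate_inv X (ln n%:R)
             <= max_matching_weight (fun e => Y n e w)
         /\ max_matching_weight (fun e => Y n e w)
             <= ((1 + eps n) * n%:R)%:E * rate_inv X (ln n%:R)]
      @[n --> \oo] --> 1.
Proof.
have symX : symmetric_RV X by case: X_good.
pose L n : R := fine (rate_inv X (ln n%:R)).
have LE n : rate_inv X (ln n%:R) = (L n)%:E by rewrite fineK// rate_inv_fin.
have L0 n : (0 <= L n)%R by rewrite -lee_fin -LE rate_inv_ge0.
pose W n w := max_matching_weight (fun e => Y n e w).
pose E n (e : R) := [set w | ((1 - e) * n%:R)%:E * rate_inv X (ln n%:R) <= W n w
  /\ W n w <= ((1 + e) * n%:R)%:E * rate_inv X (ln n%:R)].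
have mE n e : measurable (E n e).
  rewrite /E LE -!EFinM.
  rewrite (_ : [set w | _] = [set w | ((1 - e) * n%:R * L n)%:E <= W n w] `&`
      ~` [set w | ((1 + e) * n%:R * L n)%:E < W n w]).
    apply: measurableI; first exact: measurable_max_matching_ge.
    by apply: measurableC; exact: measurable_max_matching_gt.
  by apply/seteqP; split => w /= [? W1]; split=> //; move: W1; rewrite leNgt => /negP.
(* Each of the two bad events has probability at most [1 / n], and [2 / n <= 4 / n.+1]. *)
have [eps eps0 Peps] : exists2 eps : nat -> R, eps n @[n --> \oo] --> (0 : R)%R &
    \forall n \near \oo, (1 - 4 * n.+1%:R^-1)%:E <= P n (E n (eps n)).
  apply: (diagonal_sequence
    (Q := fun n e => (1 - 4 * n.+1%:R^-1)%:E <= P n (E n e))) => e e01.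
  have /andP[e0 e1] := e01.
  have [c c0 tailX] := lower_tail X_good e01.
  (* The threshold [20 / c ^+ 2] is chosen so that [expR x >= x ^+ 2 / 2] at [x = c * ln n] yields
     [expR (c * ln n) >= 10 * ln n]. *)
  have : \forall n \near \oo, [/\ (expR ((c - 1) * ln n%:R))%:E <=
      P0 [set w | ((1 - e) * L n <= X w)%R], (20 / c ^+ 2 <= ln n%:R)%R & (1 < n)%N].
    by near=> n; split; near: n;
      [exact: tailX|exact: near_le_ln_nat|exact: nbhs_infty_gt].
  apply: filterS => n [pn cn n1]; have n0 : (0 < n)%N by exact: ltn_trans n1.
  have n0R : (0 < n%:R :> R)%R by rewrite ltr0n.
  have mX : measurable [set w | ((1 - e) * L n <= X w)%R].
    apply: (measurable_preimage_RV X (A := [set x : R | ((1 - e) * L n <= x)%R])).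
    by rewrite -set_itvcy; exact: measurable_itv.
  have pE := fineK (fin_num_measure P0 _ mX); set p := fine _ in pE.
  have many : (10 * ln n%:R <= p * n%:R)%R.
    have ln0 : (0 <= ln n%:R :> R)%R by rewrite ln_ge0// ler1n.
    apply: (@le_trans _ _ (expR (c * ln n%:R))); last first.
      rewrite (_ : c * ln n%:R = (c - 1) * ln n%:R + ln n%:R)%R; last by ring.
      by rewrite expRD lnK// ler_wpM2r//; move: pn; rewrite -pE lee_fin.
    apply: le_trans (expR_ge1Dxn 1 (mulr_ge0 (ltW c0) ln0)).
    move: cn; rewrite ler_pdivrMr ?exprn_gt0// => /(ler_wpM2l ln0).
    rewrite !expr2 (_ : 2`!%:R = 2%R :> R)//; lra.
  have low := prob_max_matching_lt (Y_indep n) (Y_law n) n1 (esym pE) many.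
  have high := prob_max_matching_gt (Y_indep n) (Y_law n) symX n1 (LE n).
  have -> : P n (E n e) = 1 - P n (~` E n e).
    by rewrite -probability_setC ?setCK//; exact: measurableC.
  have mlow : measurable [set w | W n w < (n%:R * ((1 - e) * L n))%:E].
    rewrite (_ : [set w | _] =
        ~` [set w | (n%:R * ((1 - e) * L n))%:E <= W n w]).
      by apply: measurableC; exact: measurable_max_matching_ge.
    by apply/seteqP; split => w /=; rewrite ltNge => /negP.
  rewrite EFinB; apply: leeB => //.
  apply: (@le_trans _ _ (P n ([set w | W n w < (n%:R * ((1 - e) * L n))%:E] `|`
      [set w | (n%:R * L n)%:E < W n w]))).
    apply: le_measure; rewrite ?inE.
    - exact: measurableC.
    - by apply: measurableU => //; exact: measurable_max_matching_gt.
    move=> w; rewrite /E /= LE -!EFinM => /not_andP[|] /negP; rewrite -ltNge => H.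
      by left; rewrite mulrA (mulrC n%:R).
    (* Since [L n >= 0], exceeding [(1 + e) * n * L n] implies exceeding [n * L n]. *)
    right; apply: le_lt_trans H; rewrite lee_fin -mulrA.
    by rewrite ler_peMl ?mulr_ge0// lerDl ltW.
  apply: (le_trans (measureU2 _ _ _)).
  - exact: mlow.
  - exact: measurable_max_matching_gt.
  apply: (le_trans (leeD low high)); rewrite -EFinD lee_fin.
  rewrite -mulr2n -[leLHS]mulr_natl ler_pdivrMr// mulrAC ler_pdivlMr ?ltr0n//.
  by rewrite -!natrM ler_nat; lia.
exists eps => //.
apply: (@squeeze_cvge _ _ _ _ (fun n => (1 - 4 * n.+1%:R^-1)%:E) _ (fun=> 1)).
- apply: filterS Peps => n Pn; rewrite [X in X && _]Pn.
  exact: (probability_le1 (P n) (mE n _)).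
- apply: cvg_EFin; first exact: nearW.
  rewrite -[X in _ --> X](_ : (1 - 4 * 0)%R = _); last by rewrite mulr0 subr0.
  by apply: cvgB; [exact: cvg_cst|apply: cvgM; [exact: cvg_cst|exact: cvg_harmonic]].
- exact: cvg_cst.
Unshelve. all: by end_near.
Qed.
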